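(* Let $T$ be a linear relation from a Hilbert space $\mathfrak H$ to a Hilbert space $\mathfrak K$, let $\widetilde R$ be the orthogonal projection from $\mathfrak H\times\mathfrak K$ onto the closure $\overline T$, and write $\widetilde R=\begin{pmatrix}\widetilde R_{11}&\widetilde R_{12}\\ \widetilde R_{21}&\widetilde R_{22}\end{pmatrix}$ with respect to the Cartesian product $\mathfrak H\times\mathfrak K$. Then $T$ is singular if and only if $$\widetilde R_{12}=0\quad\text{or equivalently}\quad\widetilde R_{21}=0,$$ in which case $$\widetilde R=\begin{pmatrix} I{\upharpoonright}_{\overline{\operatorname{dom}}\,T}\oplus 0{\upharpoonright}_{(\operatorname{dom}T)^\perp}&0\\ 0& I{\upharpoonright}_{\overline{\operatorname{ran}}\,T}\oplus 0{\upharpoonright}_{(\operatorname{ran}T)^\perp}\end{pmatrix}.$$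
   Context: Hilbert spaces are complex. A linear relation $T$ from $\mathfrak H$ to $\mathfrak K$ is a (not necessarily closed) linear subspace of the Hilbert space $\mathfrak H\times\mathfrak K$, with elements written $\{f,f'\}$; $\overline T$ is its closure. Notation: $\operatorname{dom}T=\{f:\{f,f'\}\in T\}$, $\operatorname{ran}T=\{f':\{f,f'\}\in T\}$, $\operatorname{mul}T=\{f'\in\mathfrak K:\{0,f'\}\in T\}$; $\overline{\operatorname{dom}}\,T$ and $\overline{\operatorname{ran}}\,T$ are the closures of $\operatorname{dom}T$ and $\operatorname{ran}T$. $T$ is singular if $\operatorname{ran}T\subset\operatorname{mul}\overline T$. For a closed subspace $M$, $I{\upharpoonright}_M\oplus 0{\upharpoonright}_{M^\perp}$ denotes the orthogonal projection onto $M$. *)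

(* Defs.v *)
From HB Require Import structures.
From mathcomp Require Import all_boot all_order all_algebra.
From mathcomp Require Import sesquilinear.
From mathcomp Require Import complex.
From mathcomp Require Import all_classical all_reals all_analysis.
Set Implicit Arguments.
Unset Strict Implicit.
Unset Printing Implicit Defensive.
Import Order.TTheory GRing.Theory Num.Theory.
Import numFieldNormedType.Exports.
Local Open Scope classical_set_scope.
Local Open Scope ring_scope.

(* A complex Hilbert space over R[i]: a complete normed space whose norm comes
   from an inner product, linear in its first argument. *)
HB.mixin Record isHilbert (R : realType) H of CompleteNormedModule R[i] H := {
  inner : {dot H for @Num.conj R[i]} ;
  inner_norm : forall x : H, inner x x = `|x| ^+ 2
}.

#[short(type="hilbertType")]
HB.structure Definition Hilbert (R : realType) :=
  {H of isHilbert R H & CompleteNormedModule R[i] H}.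

(* The inner product of the Hilbert space H * K.  The library norm on H * K is
   the sup norm, so it is not the norm of this inner product; both induce the
   product topology, which is the one [closure] refers to. *)
Definition prod_inner (R : realType) (H K : hilbertType R) (u v : H * K) : R[i] :=
  inner u.1 v.1 + inner u.2 v.2.

Section ProdInner.
Context (R : realType) (H K : hilbertType R).
Local Notation ip := (@prod_inner R H K).

Let ip_bilinear :
  bilinear_for (GRing.mul : GRing.Scale.law R[i] R[i])
    (@Num.conj R[i] \; *%R : GRing.Scale.law R[i] R[i]) ip.
Proof.
split=> [w | w] a u v; rewrite /prod_inner /=.
  by rewrite !linearPl /= mulrDr addrACA.
by rewrite !linearPr /= mulrDr addrACA.
Qed.

HB.instance Definition _ := bilinear_isBilinear.Build R[i] (H * K)%type
  (H * K)%type R[i] *%R (@Num.conj R[i] \; *%R) ip ip_bilinear.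

Let ip_sym (u v : H * K) : ip u v = (-1) ^+ false * (ip v u)^*.
Proof.
rewrite /prod_inner (hermitian_subproof u.1) (hermitian_subproof u.2).
by rewrite !mul1r rmorphD.
Qed.

HB.instance Definition _ := isHermitianSesquilinear.Build R[i] (H * K)%type
  false (@Num.conj R[i]) ip ip_sym.

Let ip_gt0 (u : H * K) : u != 0 -> 0 < ip u u.
Proof.
rewrite /prod_inner !inner_norm lt_def addr_ge0 ?exprn_ge0 // andbT.
apply: contra; rewrite paddr_eq0 ?exprn_ge0 // !sqrf_eq0 !normr_eq0.
by case: u => f g /= /andP[/eqP-> /eqP->].
Qed.

HB.instance Definition _ := isDotProduct.Build R[i] (H * K)%type ip ip_gt0.
End ProdInner.

Definition orthocomp (R : realType) (V : lmodType R[i])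
    (ip : {dot V for @Num.conj R[i]}) (M : set V) : set V :=
  [set x | forall y, M y -> ip x y = 0].

(* The point y of M with x - y orthogonal to M; such a y is unique, and exists
   for every x when M is a closed subspace of a Hilbert space (otherwise the
   value may be the default 0). *)
Definition orthoproj (R : realType) (V : lmodType R[i])
    (ip : {dot V for @Num.conj R[i]}) (M : set V) (x : V) : V :=
  xget 0 [set y | M y /\ orthocomp ip M (x - y)].

Section LinearRelations.
Context (R : realType) (H K : hilbertType R).
Implicit Types T : set (H * K).

Definition linear_relation T := submod_closed (mem T).

Definition rel_dom T : set H := [set f | exists f', T (f, f')].
Definition rel_ran T : set K := [set f' | exists f, T (f, f')].
Definition rel_mul T : set K := [set f' | T (0, f')].

Definition singular_relation T := rel_ran T `<=` rel_mul (closure T).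
End LinearRelations.

(* Entries of an operator on H * K, viewed as a 2 x 2 operator matrix. *)
Section Blocks.
Context (R : realType) (H K : hilbertType R).
Implicit Types A : H * K -> H * K.

Definition block11 A : H -> H := fun f => (A (f, 0)).1.
Definition block12 A : K -> H := fun f' => (A (0, f')).1.
Definition block21 A : H -> K := fun f => (A (f, 0)).2.
Definition block22 A : K -> K := fun f' => (A (0, f')).2.

Definition block_op (A11 : H -> H) (A12 : K -> H) (A21 : H -> K)
    (A22 : K -> K) : H * K -> H * K :=
  fun u => (A11 u.1 + A12 u.2, A21 u.1 + A22 u.2).
End Blocks.

(* Main.v *)
(* If T is singular then, for {f, f'} in T, {0, f'} and hence {f, 0} lie in the
   closure of T, so the closure of T is the product of the closures of dom T and
   ran T, and its orthogonal projection acts componentwise. Conversely, if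
   R12 = 0 and {f, f'} is in T, the projection of {0, f'} has the form {0, g}, and
   f' - g is orthogonal to both f' and g, so f' = g and {0, f'} is in the closure
   of T. Finally R21 is the adjoint of R12, because orthogonal projections are
   self-adjoint. *)
Require Import Defs.
From mathcomp Require Import all_boot all_order all_algebra.
From mathcomp Require Import sesquilinear.
From mathcomp Require Import complex.
From mathcomp Require Import all_classical all_reals all_analysis.
Import Order.TTheory GRing.Theory Num.Theory.
Import numFieldNormedType.Exports.
Local Open Scope classical_set_scope.
Local Open Scope ring_scope.

(** * Linear subspaces, closures and Cauchy filters *)

Lemma submodD {C : pzRingType} {V : lmodType C} {M : set V} {u v : V} :
  submod_closed (mem M) -> M u -> M v -> M (u + v).
Proof.
move=> [_ MD] Mu Mv; rewrite -[u]scale1r.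
by apply/set_mem/MD; exact/mem_set.
Qed.

Lemma submodZ {C : pzRingType} {V : lmodType C} {M : set V} (a : C) {u : V} :
  submod_closed (mem M) -> M u -> M (a *: u).
Proof.
move=> [M0 MD] Mu; rewrite -[_ *: _]addr0.
by apply/set_mem/MD => //; exact/mem_set.
Qed.

Lemma submodB {C : pzRingType} {V : lmodType C} {M : set V} {u v : V} :
  submod_closed (mem M) -> M u -> M v -> M (u - v).
Proof.
by move=> sM Mu Mv; apply: submodD => //; rewrite -scaleN1r; exact: submodZ.
Qed.

(** By continuity of [a *: u + v] in both variables, a neighborhood of the value pulls back to one
    containing a box, and each side of the box meets [M]. *)
Lemma closure_submod (C : numFieldType) (V : normedModType C) (M : set V) :
  submod_closed (mem M) -> submod_closed (mem (closure M)).
Proof.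
move=> sM; split; first by apply/mem_set/subset_closure/set_mem; case: sM.
move=> a u v /set_mem Mu /set_mem Mv; apply/mem_set => B nB.
have /= [[A1 A2] [/= nA1 nA2] sB] : nbhs (u, v) ((fun w : V * V => a *: w.1 + w.2) @^-1` B).
  have h : (fun w : V * V => a *: w.1 + w.2) w @[w --> (u, v)] --> a *: u + v.
    apply: cvgD; last exact: cvg_snd.
    apply: cvgZr; exact: cvg_fst.
  exact: h nB.
have [u' [Mu' Au']] := Mu _ nA1; have [v' [Mv' Av']] := Mv _ nA2.
exists (a *: u' + v'); split; first by apply: submodD => //; exact: submodZ.
exact: (sB (u', v')).
Qed.

Lemma closure_setX (X Y : topologicalType) (A : set X) (B : set Y) :
  closure (A `*` B) = closure A `*` closure B.
Proof.
apply/seteqP; split=> [[x y] AB|[x y] [/= Ax By] D [[D1 D2] [/= nD1 nD2] sD]].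
  split=> /= D nD.
    have [|[x' y'] [[/= Ax' _] Dx']] := AB (fst @^-1` D); last by exists x'.
    exact: (@cvg_fst _ _ (nbhs x) (nbhs y) _ D nD).
  have [|[x' y'] [[/= _ By'] Dy']] := AB (snd @^-1` D); last by exists y'.
  exact: (@cvg_snd _ _ (nbhs x) (nbhs y) _ D nD).
have [x' [Ax' Dx']] := Ax _ nD1; have [y' [By' Dy']] := By _ nD2.
by exists (x', y'); split => //; exact: (sD (x', y')).
Qed.

(** Inner products control squared distances; using the hypothesis at [e ^+ 2] gives the usual
    Cauchy criterion. *)
Lemma sqdist_cauchy_cvg (C : numFieldType) (V : completeNormedModType C)
    (F : set_system V) : ProperFilter F ->
  (forall e, 0 < e -> exists v, \forall v' \near F, `|v - v'| ^+ 2 < e) -> cvg F.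
Proof.
move=> PF Fc; apply/cauchy_cvgP/cauchy_exP => e e0.
have [v vF] := Fc _ (exprn_gt0 2 e0); exists v.
apply: filterS vF => v'; rewrite -ball_normE/= => h.
by rewrite -(ltr_pXn2r (ltn0Sn 1)) ?nnegrE ?(ltW e0).
Qed.

(** * Geometry of an inner product *)

Section Inner.
Context {R : realType} {V : lmodType R[i]} (ip : {dot V for @Num.conj R[i]}).

Lemma parallelogram (u v : V) :
  ip (u + v) (u + v) + ip (u - v) (u - v) = (ip u u + ip v v) *+ 2.
Proof. by rewrite dnormD dnormB addrACA subrr addr0 mulr2n. Qed.

(* Evaluate the bound at [a = <w, z> / <z, z>], the minimizer over [a] of
   [|w - a z|^2]; for [d = 0] this is the Cauchy-Schwarz inequality. *)
Lemma quadratic_gap (w z : V) (d : R[i]) :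
  (forall a, d <= ip (w - a *: z) (w - a *: z)) ->
  `|ip w z| ^+ 2 <= ip z z * (ip w w - d).
Proof.
move=> dmin; have [->|z0] := eqVneq z 0.
  by rewrite !linear0r normr0 expr0n mul0r.
have zz0 : 0 < ip z z by rewrite dnorm_gt0.
have /CrealP zzJ : ip z z \is Num.real by rewrite ger0_real// ltW.
have := dmin (ip w z / ip z z).
(* For this [a] the cross term and the squared norm of [a *: z] coincide, so the expansion leaves
   [ip w w] minus a single copy of that value. *)
have crossE : ip w (ip w z / ip z z *: z) = `|ip w z| ^+ 2 / ip z z.
  by rewrite linearZr_LR/= rmorphM fmorphV/= zzJ mulrAC [X in X / _]mulrC normCK.
have sqE : `|ip w z / ip z z| ^+ 2 * ip z z = `|ip w z| ^+ 2 / ip z z.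
  by rewrite normf_div expr_div_n (gtr0_norm zz0) mulrAC -mulrA expr2 invfM mulVKf ?gt_eqF.
rewrite dnormB dnormZ crossE sqE fmorph_div rmorphXn/= zzJ.
rewrite [`|_|^*](CrealP _) ?normr_real// opprD addrA addrK.
by rewrite lerBrDr -lerBrDl ler_pdivrMr// mulrC.
Qed.

(* Parallelogram law: the midpoint of [y1] and [y2] is in [M], so it is at
   squared distance at least [d] from [x]. *)
Lemma near_minimizers {M : set V} {x y1 y2 : V} {d e1 e2 : R[i]} :
  submod_closed (mem M) -> (forall y, M y -> d <= ip (x - y) (x - y)) ->
  M y1 -> M y2 -> ip (x - y1) (x - y1) <= d + e1 ->
  ip (x - y2) (x - y2) <= d + e2 ->
  ip (y1 - y2) (y1 - y2) <= (e1 + e2) *+ 2.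
Proof.
move=> sM dmin M1 M2 d1 d2.
have := parallelogram (x - y1) (x - y2).
have -> : x - y1 - (x - y2) = y2 - y1 by rewrite opprB addrC addrA subrK.
have -> : x - y1 + (x - y2) = 2 *: (x - 2^-1 *: (y1 + y2)).
  rewrite scalerBr scalerA divff ?pnatr_eq0// scale1r -[2]/(1 *+ 2) scaler_nat.
  by rewrite mulr2n opprD addrACA.
rewrite dnormZ -(opprB y1) linearNl linearNr opprK normr_nat => pl.
have := dmin _ (submodZ 2^-1 sM (submodD sM M1 M2)).
set m := 2^-1 *: (y1 + y2) in pl *; set D := ip (x - m) (x - m) in pl * => dD.
(* The law solved for the wanted term: the [4 d] from the two upper bounds is absorbed by [4 D],
   since [d <= D]. *)
have -> : ip (y1 - y2) (y1 - y2) =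
  (ip (x - y1) (x - y1) + ip (x - y2) (x - y2)) *+ 2 - 2 ^+ 2 * D.
  by rewrite -pl addrAC subrr add0r.
rewrite lerBlDr (le_trans (ler_wMn2r 2 (lerD d1 d2)))//.
rewrite addrACA mulrnDl [leLHS]addrC lerD2l -mulr2n -mulrnA -natrX.
by rewrite mulr_natl ler_wMn2r.
Qed.

(** Uniqueness: two candidates differ by a vector of [M] that is also orthogonal to [M], hence to
    itself. *)
Lemma orthoprojE {M : set V} {x y : V} : submod_closed (mem M) ->
  M y -> orthocomp ip M (x - y) -> orthoproj ip M x = y.
Proof.
move=> sM My oy; rewrite /orthoproj; case: xgetP => [y' _ [My' oy']|/(_ y)[]//].
have Myy := submodB sM My' My.
have yyE : y' - y = (x - y) - (x - y') by rewrite opprB [RHS]addrC addrA subrK.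
by apply/eqP; rewrite -subr_eq0 -(dnorm_eq0 ip) [X in ip X _]yyE linearBl/= oy// oy'// subrr.
Qed.
End Inner.

(** * Existence of the projection onto a closed relation *)

Section Projection.
Context {R : realType} {H K : hilbertType R}.
Local Notation ip := (@prod_inner R H K).

(** Each coordinate's squared distance is at most that of the pair, so completeness of [H] and [K]
    gives the limit coordinatewise. *)
Lemma prod_inner_complete (F : set_system (H * K)) : ProperFilter F ->
  (forall e, 0 < e -> exists v, \forall v' \near F, ip (v - v') (v - v') < e) ->
  exists l : H * K, F --> l.
Proof.
move=> PF Fc.
have c1 : cvg (fst @ F).
  apply: sqdist_cauchy_cvg => e e0; have [v vF] := Fc _ e0; exists v.1.
  apply: filterS vF => v'; apply: le_lt_trans.
  by rewrite /prod_inner !inner_norm /= lerDl exprn_ge0.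
have c2 : cvg (snd @ F).
  apply: sqdist_cauchy_cvg => e e0; have [v vF] := Fc _ e0; exists v.2.
  apply: filterS vF => v'; apply: le_lt_trans.
  by rewrite /prod_inner !inner_norm /= lerDr exprn_ge0.
exists (lim (fst @ F), lim (snd @ F)).
move=> A [[A1 A2] [/= nA1 nA2] sA].
have F1 : F (fst @^-1` A1) := c1 _ nA1; have F2 : F (snd @^-1` A2) := c2 _ nA2.
by apply: filterS2 F1 F2 => -[v1 v2] ? ?; exact: sA.
Qed.

Lemma cvg_prod_inner {F : set_system (H * K)} {l : H * K} {e : R[i]} : Filter F ->
  F --> l -> 0 < e -> \forall v \near F, ip (l - v) (l - v) < e.
Proof.
move=> FF Fl e0; have e2 : 0 < e / 2 by rewrite divr_gt0.
have s0 : 0 < sqrtC (e / 2) by rewrite sqrtC_gt0.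
have F1 : fst @ F --> l.1 by move=> A nA; apply: Fl; exact: (@cvg_fst _ _ (nbhs l.1) (nbhs l.2) _ A nA).
have F2 : snd @ F --> l.2 by move=> A nA; apply: Fl; exact: (@cvg_snd _ _ (nbhs l.1) (nbhs l.2) _ A nA).
move/cvgrPdist_lt : F2 => /(_ _ s0); move/cvgrPdist_lt : F1 => /(_ _ s0).
apply: filterS2 => v v1 v2.
by rewrite /prod_inner !inner_norm [e]splitr -(sqrtCK (e / 2)) ltrD// ltr_sqr ?nnegrE ?(ltW s0).
Qed.

(* [F] is the filter of near-minimizers of the squared distance to [x]; by
   [near_minimizers] it is Cauchy, and by [quadratic_gap] its limit [l] satisfies
   [<x - l, z> = 0] for [z] in the closure. *)
Lemma orthoproj_closureP (T : set (H * K)) (x : H * K) : submod_closed (mem T) ->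
  closure T (orthoproj ip (closure T) x) /\
  orthocomp ip (closure T) (x - orthoproj ip (closure T) x).
Proof.
move=> /closure_submod; set M := closure T => sM.
suff [y [My oy]] : exists y, M y /\ orthocomp ip M (x - y) by rewrite (orthoprojE ip sM My oy).
have M0 : M 0 by apply: set_mem; case: sM.
(* The infimum is taken in [R], so squared distances enter through their real parts; by [normE]
   nothing is lost. *)
pose D := [set complex.Re (ip (x - y) (x - y)) | y in M].
have normE y : ip (x - y) (x - y) = (complex.Re (ip (x - y) (x - y)))%:C%C.
  by rewrite RRe_real// ger0_real// dnorm_ge0.
have D0 : D !=set0 by exists (complex.Re (ip (x - 0) (x - 0))); exists 0.
have Dlb : lbound D 0.
  by move=> _ [y My <-]; rewrite -lecR -normE; exact: dnorm_ge0.
pose d := (inf D)%:C%C.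
have dmin y : M y -> d <= ip (x - y) (x - y).
  by move=> My; rewrite normE lecR; apply: ge_inf; [exists 0|exists y].
pose B (e : R) := [set y | M y /\ ip (x - y) (x - y) <= d + e%:C%C].
pose F := filter_from [set e | 0 < e] B.
have PF : ProperFilter F.
  apply: filter_from_proper.
    apply: filter_from_filter; first by exists 1 => /=.
    move=> e1 e2 /= e10 e20; exists (Num.min e1 e2) => /=; first by rewrite lt_min e10.
    move=> y [My]; rewrite /d -raddfD normE lecR => h.
    by split; split => //; rewrite normE -raddfD lecR (le_trans h)// lerD2l ge_min lexx ?orbT.
  move=> e /= e0; have [|_ [y My <-] h] := inf_adherent e0 (conj D0 _); first by exists 0.
  by exists y; split => //; rewrite normE -raddfD lecR ltW.
have FB e : 0 < e -> F (B e) by move=> e0; exists e.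
have epsE (e : R[i]) : 0 < e -> exists2 e' : R, 0 < e' & e = e'%:C%C.
  move=> e0; have eE : e = (complex.Re e)%:C%C by rewrite RRe_real// gtr0_real.
  by exists (complex.Re e) => //; rewrite -ltcR -eE.
have [l Fl] : exists l : H * K, F --> l.
  apply: prod_inner_complete => _ /epsE[e e0 ->].
  (* Two errors of [e / 8], doubled by [near_minimizers], add up to [e / 2 < e]. *)
  have e8 : 0 < e / 8 by rewrite divr_gt0.
  have [y [My dy]] := filter_ex (FB _ e8); exists y.
  apply: filterS (FB _ e8) => y' [My' dy'].
  apply: le_lt_trans (near_minimizers ip sM dmin My My' dy dy') _.
  rewrite -raddfD -raddfMn ltcR -mulr2n -mulrnA -[ltLHS]mulr_natr.
  by rewrite -mulrA gtr_pMr// mulrC ltr_pdivrMr// mul1r ltr_nat.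
have FM : \forall y \near F, M y by apply: filterS (FB _ ltr01) => y [].
have Ml : M l := @closed_cvg _ _ F PF id M (@closed_closure _ T) FM _ Fl.
exists l; split=> // z Mz.
set p := ip (x - l) z; apply/eqP; apply: contraT; rewrite -normr_gt0 => p0.
have zz0 : 0 <= ip z z := dnorm_ge0 _ z.
(* The bounds below give [|p| <= 2 s] with [s ^+ 2 = ip z z * e], so [|p| ^+ 2 <= 4 * ip z z * e].
   The added 1 makes this contradict the choice of [e], and keeps the denominator positive when
   [z = 0]. *)
have e0 : 0 < `|p| ^+ 2 / (4 * (ip z z + 1)).
  by rewrite divr_gt0 ?exprn_gt0// mulr_gt0 ?ltr_wpDl.
have [e' e'0 eE] := epsE _ e0.
have [y [[My dy] ly]] := filter_ex (filterI (FB _ e'0) (cvg_prod_inner _ Fl e0)).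
rewrite -eE in dy; set e := _ / _ in e0 eE dy ly.
pose s := sqrtC (ip z z * e); have s0 : 0 <= s by rewrite sqrtC_ge0 mulr_ge0// ltW.
have boundE (a : R[i]) c : `|a| ^+ 2 <= ip z z * c -> c <= e -> `|a| <= s.
  move=> ac ce; rewrite -ler_sqr ?nnegrE// sqrtCK.
  by rewrite (le_trans ac)// ler_wpM2l.
(* Moving [y] along [z] stays in [M], so [d] bounds all the squared distances, and the gap at [y] is
   at most [e]. *)
have xyz : `|ip (x - y) z| <= s.
  apply: boundE (quadratic_gap ip _ _ d _) _; last by rewrite lerBlDl.
  by move=> a; rewrite -addrA -opprD; exact: dmin (submodD sM My (submodZ a sM Mz)).
have lyz : `|ip (l - y) z| <= s.
  apply: boundE (quadratic_gap ip _ _ 0 _) _; first by move=> a; exact: dnorm_ge0.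
  by rewrite subr0 ltW.
have : `|p| <= s + s.
  rewrite /p (_ : x - l = (x - y) - (l - y)); last by rewrite opprB addrA subrK.
  by rewrite linearBl/= (le_trans (ler_normB _ _))// lerD.
rewrite -ler_sqr ?nnegrE ?addr_ge0// -mulr2n -[s *+ 2]mulr_natl exprMn sqrtCK -natrX.
have pE : `|p| ^+ 2 = 4 * (ip z z + 1) * e.
  by rewrite mulrC divfK// gt_eqF// mulr_gt0 ?ltr_wpDl.
by rewrite mulrA pE ler_pM2r// ler_pM2l// gerDl ler10.
Qed.

(** * Singular relations and the blocks of the projection *)

Lemma rel_dom_submod (T : set (H * K)) :
  submod_closed (mem T) -> submod_closed (mem (rel_dom T)).
Proof.
move=> sT; split; first by apply/mem_set; exists 0; apply: set_mem; case: sT.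
move=> a f g /set_mem[f' Tf] /set_mem[g' Tg]; apply/mem_set; exists (a *: f' + g').
exact: submodD sT (submodZ a sT Tf) Tg.
Qed.

Lemma rel_ran_submod (T : set (H * K)) :
  submod_closed (mem T) -> submod_closed (mem (rel_ran T)).
Proof.
move=> sT; split; first by apply/mem_set; exists 0; apply: set_mem; case: sT.
move=> a f' g' /set_mem[f Tf] /set_mem[g Tg]; apply/mem_set; exists (a *: f + g).
exact: submodD sT (submodZ a sT Tf) Tg.
Qed.

Lemma singular_closure (T : set (H * K)) : linear_relation T -> singular_relation T ->
  closure T = closure (rel_dom T) `*` closure (rel_ran T).
Proof.
move=> /closure_submod sT sing; rewrite -closure_setX; apply/seteqP; split.
  by apply: closureS => -[f f'] Tf; split; [exists f'|exists f].
(* As [closure T] is its own closure, it suffices to place [rel_dom T] times [rel_ran T] inside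
   it. *)
have /closure_id clT := @closed_closure _ T; rewrite [X in _ `<=` X]clT.
apply: closureS => -[f g'] [/= [f' Tf] rg'].
have -> : (f, g') = (f, f') - (0, f') + (0, g') :> H * K.
  by congr pair => /=; rewrite ?subr0 ?addr0// subrr add0r.
apply: (submodD sT) (sing _ rg').
by apply: (submodB sT) (subset_closure Tf) (sing _ _); exists f.
Qed.

Lemma singular_orthoproj (T : set (H * K)) :
  linear_relation T -> singular_relation T ->
  orthoproj ip (closure T) =
  block_op (orthoproj inner (closure (rel_dom T))) (fun=> 0)
           (fun=> 0) (orthoproj inner (closure (rel_ran T))).
Proof.
move=> linT sing; apply/funext => u.
have [] := orthoproj_closureP T u linT; rewrite (singular_closure _ linT sing).
have sD := closure_submod _ _ _ (rel_dom_submod _ linT).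
have sN := closure_submod _ _ _ (rel_ran_submod _ linT).
case: (orthoproj _ _ _) => y1 y2 [/= My1 My2] oy; rewrite /block_op addr0 add0r; congr pair.
  symmetry; apply: orthoprojE => // g Mg.
  (* Testing against pairs with one zero entry, which lie in the product of subspaces, separates the
     coordinates. *)
  have := oy (g, 0) (conj Mg (set_mem sN.1)).
  by rewrite /= /prod_inner/= linear0r addr0.
symmetry; apply: orthoprojE => // g Mg.
have := oy (0, g) (conj (set_mem sD.1) Mg).
by rewrite /= /prod_inner/= linear0r add0r.
Qed.

(** Both sides equal [ip Pu Pv], because [u - Pu] and [v - Pv] are orthogonal to the closure. *)
Lemma orthoproj_adjoint (T : set (H * K)) (u v : H * K) : linear_relation T ->
  ip (orthoproj ip (closure T) u) v = ip u (orthoproj ip (closure T) v).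
Proof.
move=> linT; have [Mu ou] := orthoproj_closureP T u linT.
have [Mv ov] := orthoproj_closureP T v linT.
set Pu := orthoproj _ _ u in Mu ou *; set Pv := orthoproj _ _ v in Mv ov *.
have vPu : ip Pu (v - Pv) = 0.
  by rewrite (hermitian_subproof Pu (v - Pv)); have /= -> := ov _ Mu; rewrite rmorph0 mulr0.
rewrite -[v in LHS](subrK Pv) -[u in RHS](subrK Pu) linearDr linearDl/= vPu.
by have /= -> := ou _ Mv.
Qed.

Lemma inner_block12 (T : set (H * K)) (f : H) (f' : K) : linear_relation T ->
  inner (block12 (orthoproj ip (closure T)) f') f =
  inner f' (block21 (orthoproj ip (closure T)) f).
Proof.
move=> linT; have := orthoproj_adjoint T (0, f') (f, 0) linT.
by rewrite /= /prod_inner/= linear0r linear0l addr0 add0r.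
Qed.

Lemma block12_singular (T : set (H * K)) : linear_relation T ->
  block12 (orthoproj ip (closure T)) = (fun=> 0) -> singular_relation T.
Proof.
move=> linT b12 f' [f Tf]; rewrite /rel_mul/=.
have [] := orthoproj_closureP T (0, f') linT.
have := congr1 (fun F => F f') b12; rewrite /block12.
case: (orthoproj _ _ _) => g g' /= -> Mg og.
have := og _ (subset_closure Tf); have := og _ Mg.
rewrite /= /prod_inner/= subr0 !linear0l !add0r => gg fg.
have /eqP : inner (f' - g') (f' - g') = 0 by rewrite linearBr/= fg gg subrr.
by rewrite dnorm_eq0 subr_eq0 => /eqP->.
Qed.
End Projection.

Theorem proposition7p2 (R : realType) (H K : hilbertType R) (T : set (H * K))
    (linT : linear_relation T) :
  let Rt := orthoproj (@prod_inner R H K) (closure T) in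
  [/\ singular_relation T <-> block12 Rt = (fun=> 0),
      block12 Rt = (fun=> 0) <-> block21 Rt = (fun=> 0) &
      singular_relation T ->
      Rt = block_op (orthoproj inner (closure (rel_dom T))) (fun=> 0)
                    (fun=> 0) (orthoproj inner (closure (rel_ran T)))].
Proof.
move=> Rt.
have b12 : singular_relation T <-> block12 Rt = (fun=> 0).
  split=> [sing|]; last exact: block12_singular.
  apply/funext => f'; rewrite /block12 /Rt singular_orthoproj//= addr0.
  (* What remains is that the projection onto the closed domain sends 0 to 0. *)
  apply: orthoprojE; first exact: closure_submod (rel_dom_submod _ linT).
    by apply/set_mem; case: (closure_submod _ _ _ (rel_dom_submod _ linT)).
  by move=> y _; rewrite subrr linear0l.
split=> //; last exact: singular_orthoproj.
(* The squared norm of a value of one block is, by adjointness, an inner product with a value of the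
   other block, which vanishes. *)
split=> b0; apply/funext => f; apply/eqP; rewrite -(dnorm_eq0 inner).
  by rewrite -inner_block12// b0 linear0l.
by rewrite inner_block12// b0 linear0r.
Qed.
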